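(* Let $n$ be a positive integer, let $\mathcal N=\{0,1,\dots,n-1\}$, and let $\mathcal M\subset\mathcal N$ with $|\mathcal M|=m$. Let $p\ge 1$ and let $\mathcal B=\bigcup_{k=1}^p[f_{L_k},f_{H_k}]$ be a union of $p$ disjoint frequency bands $[f_{L_k},f_{H_k}]\subset[0,1]$. Let $x\in\mathbb C^n$ be a signal $x[l]=\sum_{j=1}^s c_je^{i2\pi f_jl}$, $l\in\mathcal N$, with complex coefficients $c_j\neq 0$ and all frequencies $f_j\in\mathcal B$. Consider the optimization problem (D) maximize $\langle q_{\mathcal M},x_{\mathcal M}\rangle_{\mathbb R}$ over $q\in\mathbb C^n$ subject to $q_l=0$ for all $l\in\mathcal N\setminus\mathcal M$ and, for every $j=1,\dots,p$, $$\sup_{f\in[f_{L_j},f_{H_j}]}\Big|\sum_{l=0}^{n-1}q_l e^{-i2\pi f l}\Big|\le 1,$$ and the semidefinite program (S) maximize $\langle q_{\mathcal M},x_{\mathcal M}\rangle_{\mathbb R}$ over $q\in\mathbb C^n$, positive semidefinite matrices $Q_{11},\dots,Q_{1p}\in\mathbb C^{n\times n}$ and positive semidefinite matrices $Q_{21},\dots,Q_{2p}\in\mathbb C^{(n-1)\times(n-1)}$, subject to $q_l=0$ for all $l\in\mathcal N\setminus\mathcal M$ and, for every $j=1,\dots,p$, $$\delta_k=\mathcal L_{k,f_{L_j},f_{H_j}}(Q_{1j},Q_{2j})\quad (k=0,1,\dots,n-1),\qquad \begin{bmatrix}Q_{1j}&q\\ q^*&1\end{bmatrix}\succeq 0,$$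 where $\delta_0=1$ and $\delta_k=0$ for $k\ne 0$. Then (D) is equivalent to the semidefinite program (S): for each band $[f_{L_j},f_{H_j}]$, the constraint $\sup_{f\in[f_{L_j},f_{H_j}]}\big|\sum_{l=0}^{n-1}q_l e^{-i2\pi f l}\big|\le 1$ holds if and only if there exist positive semidefinite matrices $Q_{1j}\in\mathbb C^{n\times n}$ and $Q_{2j}\in\mathbb C^{(n-1)\times(n-1)}$ satisfying the constraints of (S) for that $j$.
   Context: Here $i=\sqrt{-1}$, $q^*$ is the conjugate transpose of the column vector $q=(q_0,\dots,q_{n-1})^T$, $\succeq 0$ means Hermitian positive semidefinite, and $\langle q_{\mathcal M},x_{\mathcal M}\rangle_{\mathbb R}=\mathrm{Re}\sum_{l\in\mathcal M}\overline{x_l}\,q_l$. Problem (D) is the dual of minimizing, over all $\hat x\in\mathbb C^n$ with $\hat x[l]=x[l]$ for $l\in\mathcal M$, the constrained atomic norm of $\hat x$, i.e. the infimum of $\sum_j|c_j|$ over representations of $\hat x$ as $\sum_j c_je^{i2\pi f_jl}$ with all $f_j\in\mathcal B$. In the intended setting $m\ll n$ and $\mathcal M$ is chosen uniformly at random. Definition of $\mathcal L_{k,f_L,f_H}$. For a band endpoint $f\in[0,1]$ put $\omega=2\pi f$ if $0\le f\le 0.5$ and $\omega=2\pi(f-1)$ if $0.5<f\le1$; let $\omega_L,\omega_H$ be the values obtained from $f_L,f_H$. Put $\alpha=\tan(\omega_L/2)$, $\beta=\tan(\omega_H/2)$, $$d_0=-\frac{\alpha\beta+1}{2},\qquad d_1=\frac{1-\alpha\beta}{4}+i\,\frac{\alpha+\beta}{4}.$$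 For an integer $k$, let $\Theta_k$ denote the elementary Toeplitz matrix with ones on the $k$-th diagonal and zeros elsewhere. It has size $n\times n$ when multiplied with an $n\times n$ matrix and size $(n-1)\times(n-1)$ when multiplied with an $(n-1)\times(n-1)$ matrix; in the latter case $\Theta_k=0$ if $k>n-2$. For $Q_1\in\mathbb C^{n\times n}$ and $Q_2\in\mathbb C^{(n-1)\times(n-1)}$, $$\mathcal L_{k,f_L,f_H}(Q_1,Q_2)=\mathrm{tr}[\Theta_kQ_1]+\mathrm{tr}\big[(d_1\Theta_{k-1}+d_0\Theta_k+\overline{d_1}\,\Theta_{k+1})Q_2\big].$$
   Formalization: Each band is assumed to have f_L < f_H and not to contain 1/2: for n ≥ 2 the equivalence fails for one-point bands and for bands with 1/2 in the interior, and at an endpoint 1/2 the tangent tan(π/2) in the definition of L is undefined. *)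

(* Defs.v *)
From HB Require Import structures.
From mathcomp Require Import all_boot all_order all_algebra.
From mathcomp Require Import all_classical all_reals all_analysis.
From mathcomp Require Import complex.

Set Implicit Arguments.
Unset Strict Implicit.
Unset Printing Implicit Defensive.

Import Order.TTheory GRing.Theory Num.Theory.
Import ComplexField.Normc.

Local Open Scope classical_set_scope.
Local Open Scope ring_scope.
Local Open Scope complex_scope.
Local Open Scope sesquilinear_scope.

Section Definitions.
Variable R : realType.
Local Notation C := R[i].

Definition cis (t : R) : C := cos t +i* sin t.

(* The order of R[i] makes [0 <= z] include that z is real. *)
Definition psdmx (n : nat) (A : 'M[C]_n) : Prop :=
  A \is hermsymmx /\ forall v : 'cV[C]_n, 0 <= (v^t* *m A *m v) 0 0.

Definition in_bands (p : nat) (fL fH : 'I_p -> R) : set R :=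
  \bigcup_(k in [set: 'I_p]) `[fL k, fH k]%classic.

(* Endpoints in [0, 1] are mapped to angles in (-pi, pi]. At f = 1/2 the angle
   is pi, where tan (omega f / 2) is undefined (0 by convention in the library);
   a band with 1/2 in its interior has omega fH <= 0 <= omega fL, and then
   d0 + 2 Re (d1 exp(-i t)) is nonnegative outside the band instead of on it. *)
Definition omega (f : R) : R :=
  if f <= 1 / 2 then 2 * pi * f else 2 * pi * (f - 1).

Definition d0 (fL fH : R) : C :=
  let a := tan (omega fL / 2) in
  let b := tan (omega fH / 2) in
  (- ((a * b + 1) / 2))%:C.

Definition d1 (fL fH : R) : C :=
  let a := tan (omega fL / 2) in
  let b := tan (omega fH / 2) in
  ((1 - a * b) / 4) +i* ((a + b) / 4).

(* Positive diagonals lie above the main one, so that the sequence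
   [\tr (Theta n k *m (q *m q^t* ))] consists of the coefficients of
   exp(-i k t) in the squared modulus of [\sum_l q_l exp(-i l t)]. *)
Definition Theta (n : nat) (k : int) : 'M[C]_n :=
  \matrix_(i < n, j < n) ((j : nat)%:Z - (i : nat)%:Z == k)%:R.

Definition calL (n : nat) (k : int) (fL fH : R)
    (Q1 : 'M[C]_n) (Q2 : 'M[C]_n.-1) : C :=
  \tr (Theta n k *m Q1)
  + \tr ((d1 fL fH *: Theta n.-1 (k - 1) + d0 fL fH *: Theta n.-1 k
          + (d1 fL fH)^*%C *: Theta n.-1 (k + 1)) *m Q2).

Definition trig_poly (n : nat) (q : 'cV[C]_n) (f : R) : C :=
  \sum_(l < n) q l 0 * cis (- (2 * pi * f * l%:R)).

Definition pairing (n : nat) (M : {set 'I_n}) (q x : 'cV[C]_n) : R :=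
  complex.Re (\sum_(l in M) (x l 0)^*%C * q l 0).

Definition vanishes_off (n : nat) (M : {set 'I_n}) (q : 'cV[C]_n) : Prop :=
  forall l : 'I_n, l \notin M -> q l 0 = 0.

Definition band_bound (n : nat) (fL fH : R) (q : 'cV[C]_n) : Prop :=
  (ereal_sup [set (normc (trig_poly q f))%:E | f in `[fL, fH]%classic] <= 1)%E.

Definition band_sdp (n : nat) (fL fH : R) (q : 'cV[C]_n)
    (Q1 : 'M[C]_n) (Q2 : 'M[C]_n.-1) : Prop :=
  [/\ psdmx Q1, psdmx Q2,
      forall k : nat, (k < n)%N -> (k == 0%N)%:R = calL k%:Z fL fH Q1 Q2
    & psdmx (block_mx Q1 q (q^t*) 1%:M)].

Definition feasibleD (n p : nat) (M : {set 'I_n}) (fL fH : 'I_p -> R)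
    (q : 'cV[C]_n) : Prop :=
  vanishes_off M q /\ forall j, band_bound (fL j) (fH j) q.

Definition variablesS (n p : nat) : Type :=
  ('cV[C]_n * ('I_p -> 'M[C]_n) * ('I_p -> 'M[C]_n.-1))%type.

Definition feasibleS (n p : nat) (M : {set 'I_n}) (fL fH : 'I_p -> R)
    (u : variablesS n p) : Prop :=
  let: (q, Q1, Q2) := u in
  vanishes_off M q /\ forall j, band_sdp (fL j) (fH j) q (Q1 j) (Q2 j).

Definition opt_value (V : Type) (F : set V) (obj : V -> R) : \bar R :=
  ereal_sup [set (obj v)%:E | v in F].

Definition maximizer (V : Type) (F : set V) (obj : V -> R) (v : V) : Prop :=
  F v /\ forall w, F w -> obj w <= obj v.

End Definitions.

(* Main.v *)
(* By Schur complements, the block constraint says that Q1 - q q^* is positive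
   semidefinite, and matching diagonal sums amounts to
     1 = a^* Q1 a + D(w) b^* Q2 b
   at all points exp(- i w) of the unit circle, where a, b are the vectors of
   powers of exp(i w) and D(w) = d0 + 2 Re (d1 exp(- i w)) is nonnegative on the
   band.  This gives |sum_l q_l exp(- i l w)|^2 <= a^* Q1 a <= 1 on the band.

   Conversely, the arc exp(- i w), w in the band, is parametrized by u >= 0 via
     tan (w / 2) = (al + be u) / (1 + u),  exp(- i w) = conj (W u) / W u,
     W u = (1 + i al) + (1 + i be) u,
   and D(w) = (be - al)^2 u / |W u|^2.  With N = n - 1, the function
   |W u|^(2 N) (1 - |sum_l q_l exp(- i l w)|^2) is a real polynomial in u of
   degree at most 2 N, nonnegative for u >= 0, hence of the form
   F1^2 + F2^2 + u (G1^2 + G2^2): substitute u = y^2 and take the even and odd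
   parts of a decomposition into two squares.  Since W and conj W span the
   polynomials of degree at most 1, F / W^N is a polynomial of degree at most N
   in exp(- i w), and likewise for G; their coefficient vectors yield Q1 - q q^*
   and Q2 as sums of two rank-one matrices. *)
Require Import Defs.
From mathcomp Require Import all_boot all_order all_algebra.
From mathcomp Require Import all_classical all_reals all_analysis.
From mathcomp Require Import complex polyrcf.
From mathcomp Require Import ring lra zify.

Import Order.TTheory GRing.Theory Num.Theory.
Local Open Scope classical_set_scope.
Local Open Scope ring_scope.
Local Open Scope complex_scope.
Local Open Scope sesquilinear_scope.

Set Implicit Arguments.
Unset Strict Implicit.
Unset Printing Implicit Defensive.

(** * Sums of squares of real polynomials *)

(** By continuity; this recovers the sign of a quotient at the very root that was divided out. *)
Lemma horner_ge0_right (R : rcfType) (p : {poly R}) (a : R) :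
  (forall x, a < x -> 0 <= p.[x]) -> 0 <= p.[a].
Proof.
move=> p_ge0; rewrite leNgt; apply/negP => pa_lt0.
have [|d d_gt0 dP] := @poly_cont _ a p (- p.[a]); first by rewrite oppr_gt0.
have /dP : `|a + d / 2 - a| < d by rewrite addrAC subrr add0r gtr0_norm; lra.
by have := p_ge0 (a + d / 2); rewrite ltr_distl; lra.
Qed.

Lemma horner_ge0_left (R : rcfType) (p : {poly R}) (a : R) :
  (forall x, x < a -> 0 <= p.[x]) -> 0 <= p.[a].
Proof.
move=> p_ge0; rewrite leNgt; apply/negP => pa_lt0.
have [|d d_gt0 dP] := @poly_cont _ a p (- p.[a]); first by rewrite oppr_gt0.
have /dP : `|a - d / 2 - a| < d by rewrite addrAC subrr add0r normrN gtr0_norm; lra.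
by have := p_ge0 (a - d / 2); rewrite ltr_distl; lra.
Qed.

(* Both real double roots and conjugate pairs a +- ib contribute a factor
   (X - a)^2 + b^2. *)
Lemma nonneg_poly_factor (R : rcfType) (p : {poly R}) :
  (1 < size p)%N -> (forall x, 0 <= p.[x]) ->
  exists a b (q : {poly R}), p = (('X - a%:P) ^+ 2 + (b ^+ 2)%:P) * q /\
    forall x, 0 <= q.[x].
Proof.
move=> sp p_ge0.
have /closed_rootP[[a b] /rootP rab] :
  size (map_poly (real_complex R) p) != 1%N by rewrite size_map_poly neq_ltn sp orbT.
have [b0|b_neq0] := eqVneq b 0.
  have /factor_theorem[q1 pE] : root p a.
    apply/rootP; apply: (@complexI R).
    by rewrite -horner_map /= -[RHS]rab b0.
  (* As [p = q1 * (X - a)] is nonnegative, [q1] is nonpositive left of [a] and nonnegative right of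
     it; so a real root is at least double. *)
  have q1a0 : q1.[a] = 0.
    apply/eqP; rewrite eq_le; apply/andP; split.
      rewrite -oppr_ge0 -hornerN; apply: horner_ge0_left => x xa.
      have := p_ge0 x; rewrite pE hornerM hornerXsubC hornerN.
      have xa' : x - a < 0 by lra.
      by rewrite nmulr_lge0 // oppr_ge0.
    apply: horner_ge0_right => x xa.
    have := p_ge0 x; rewrite pE hornerM hornerXsubC.
    by rewrite pmulr_lge0 // subr_gt0.
  have /factor_theorem[q q1E] : root q1 a by apply/rootP.
  have pE' : p = (('X - a%:P) ^+ 2 + (0 ^+ 2)%:P) * q.
    by rewrite expr0n /= addr0 pE q1E; ring.
  exists a, 0, q; split => //.
  have q_ge0 x : x != a -> 0 <= q.[x].
    move=> xa; have := p_ge0 x; rewrite pE' hornerM !hornerE.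
    rewrite expr0n /= addr0 pmulr_rge0 //.
    by rewrite exprn_even_gt0 //= subr_eq0.
  move=> x; have [->|] := eqVneq x a; last exact: q_ge0.
  by apply: horner_ge0_right => y ya; apply: q_ge0; rewrite gt_eqF.
set m := ('X - a%:P) ^+ 2 + (b ^+ 2)%:P.
have size_sq : size (('X - a%:P) ^+ 2 : {poly R}) = 3%N by rewrite size_exp_XsubC.
have size_m : size m = 3%N.
  by rewrite size_polyDl size_sq // (leq_ltn_trans (size_polyC_leq1 _)).
(* The remainder has real coefficients and degree at most 1 and vanishes at the nonreal point
   [a + i b], hence it is zero. *)
have pE := divp_eq p m; set r : {poly R} := p %% m in pE.
have sr : (size r <= 2)%N by rewrite -ltnS -size_m ltn_modp -size_poly_eq0 size_m.
have mab : (map_poly (real_complex R) m).[a +i* b] = 0.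
  rewrite rmorphD rmorphXn /= rmorphB /= map_polyX !map_polyC /= !hornerE.
  by rewrite /=; apply/eqP; rewrite eq_complex /=; apply/andP; split; apply/eqP; ring.
have r0 : r = 0.
  have rE : r = (r`_0)%:P + r`_1 *: 'X.
    apply/polyP => -[|[|k]]; rewrite !coefE /= ?mulr0 ?mulr1 ?addr0 ?add0r //.
    by rewrite nth_default ?addr0 // (leq_trans sr).
  move: rab; rewrite pE rmorphD rmorphM /= hornerD hornerM mab mulr0 add0r.
  rewrite rE rmorphD /= map_polyZ /= map_polyX map_polyC /= !hornerE /=.
  move/eqP; rewrite eq_complex /= => /andP[/eqP E1 /eqP E2].
  have r1 : r`_1 = 0.
    by apply: (mulIf b_neq0); rewrite mul0r -[RHS]E2; ring.
  have r00 : r`_0 = 0 by rewrite -[RHS]E1 r1; ring.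
  by move: rE; rewrite r1 r00 scale0r addr0 polyC0.
exists a, b, (p %/ m); split; first by rewrite {1}pE r0 addr0 mulrC.
move=> x; have := p_ge0 x; rewrite {1}pE r0 addr0 hornerM pmulr_lge0 //.
rewrite !hornerE /=; apply: ltr_wpDl; first exact: sqr_ge0.
by rewrite exprn_even_gt0.
Qed.

(** Quadratic factors are peeled off one at a time, since sums of two squares are closed under
    products. The bounds say that [A] and [B] have at most half the degree of [p], and that they
    vanish if [p = 0]. *)
Lemma nonneg_poly_two_squares (R : rcfType) (p : {poly R}) :
  (forall x, 0 <= p.[x]) ->
  exists A B : {poly R}, [/\ p = A ^+ 2 + B ^+ 2,
    ((size A).*2 <= (size p).+1)%N & ((size B).*2 <= (size p).+1)%N].
Proof.
have [k] := ubnP (size p); elim: k p => // k IH p spk p_ge0.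
have [sp|sp] := leqP (size p) 1.
  have pE := size1_polyC sp; have c_ge0 : 0 <= p`_0.
    by have := p_ge0 0; rewrite pE hornerC coefC.
  exists (Num.sqrt p`_0)%:P, 0; split; last by rewrite size_poly0.
    by rewrite expr0n /= addr0 -rmorphXn /= sqr_sqrtr.
  rewrite {2}pE !size_polyC sqrtr_eq0.
  by have [->|] := eqVneq p`_0 0; rewrite ?lexx //=; case: (_ <= _).
have [a [b [q [pE q_ge0]]]] := nonneg_poly_factor sp p_ge0.
set m := _ + _ in pE.
have size_sq : size (('X - a%:P) ^+ 2 : {poly R}) = 3%N by rewrite size_exp_XsubC.
have size_m : size m = 3%N.
  by rewrite size_polyDl size_sq // (leq_ltn_trans (size_polyC_leq1 _)).
have q_neq0 : q != 0 by apply: contraTneq sp => q0; rewrite pE q0 mulr0 size_poly0.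
have spE : size p = (size q).+2.
  by rewrite pE size_mul // -?size_poly_eq0 size_m //=; lia.
have [|A [B [qE sA sB]]] := IH q _ q_ge0; first by lia.
have lin (c : R) (F G : {poly R}) :
    ((size F).*2 <= (size q).+1)%N -> ((size G).*2 <= (size q).+1)%N ->
    ((size (('X - a%:P) * F + c%:P * G)%R).*2 <= (size p).+1)%N.
  move=> sF sG.
  have h : (size (('X - a%:P) * F + c%:P * G)%R <= maxn (size F).+1 (size G))%N.
    apply: leq_trans (size_polyD _ _) _; rewrite geq_max; apply/andP; split.
      by rewrite leq_max (leq_trans (size_polyMleq _ _)) // size_XsubC.
    by rewrite leq_max mul_polyC size_scale_leq orbT.
  rewrite spE; move: h sF sG; lia.
(* The two-square identity for the product of [(X - a)^2 + b^2] and [A^2 + B^2]. *)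
exists (('X - a%:P) * A + (- b)%:P * B), (('X - a%:P) * B + b%:P * A).
split; [|exact: lin..].
by rewrite pE qE /m polyCN polyC_exp; ring.
Qed.

(* Splitting the squares of p(X^2) = A^2 + B^2 into even and odd parts. *)
Lemma nonneg_poly_halfline (R : rcfType) (N : nat) (p : {poly R}) :
  (size p <= N.*2.+1)%N -> (forall u, 0 <= u -> 0 <= p.[u]) ->
  exists F1 F2 G1 G2 : {poly R},
  [/\ (size F1 <= N.+1)%N /\ (size F2 <= N.+1)%N,
      (size G1 <= N)%N /\ (size G2 <= N)%N
    & forall u, 0 <= u ->
        p.[u] = F1.[u] ^+ 2 + F2.[u] ^+ 2 + u * (G1.[u] ^+ 2 + G2.[u] ^+ 2)].
Proof.
move=> sp p_ge0.
have [|A [B [pE sA sB]]] := @nonneg_poly_two_squares _ (p \Po 'X^2).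
  by move=> x; rewrite horner_comp hornerXn p_ge0 ?sqr_ge0.
have sp2 : (size (p \Po 'X^2) <= (N.*2).*2.+1)%N.
  have := size_comp_poly_leq p 'X^2; rewrite size_polyXn; nia.
have sAe := size_even_poly A; have sAo := size_odd_poly A.
have sBe := size_even_poly B; have sBo := size_odd_poly B.
exists (even_poly A), (even_poly B), (odd_poly A), (odd_poly B).
split; [split; lia|split; lia|].
have split_horner (C : {poly R}) y :
    C.[y] = (even_poly C).[y ^+ 2] + (odd_poly C).[y ^+ 2] * y.
  by rewrite -{1}(poly_even_odd C) !hornerE !horner_comp !hornerE.
move=> u u_ge0; set y := Num.sqrt u; have yu : y ^+ 2 = u by rewrite sqr_sqrtr.
(* Averaging the values at [y] and [- y] cancels the cross terms between even and odd parts. *)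
have E1 : p.[u] = A.[y] ^+ 2 + B.[y] ^+ 2.
  by rewrite -yu -[X in _.[X]]hornerXn -horner_comp pE !hornerE.
have E2 : p.[u] = A.[- y] ^+ 2 + B.[- y] ^+ 2.
  by rewrite -yu -[y ^+ 2]sqrrN -[X in _.[X]]hornerXn -horner_comp pE !hornerE.
rewrite (split_horner A) (split_horner B) yu in E1.
rewrite (split_horner A) (split_horner B) sqrrN yu in E2.
rewrite -[X in _ + X * _]yu; move: E1 E2; clear=> E1 E2; lra.
Qed.

(** * Sums of squares on an arc of the unit circle *)

(** This is [b^k f(a / b)] with denominators cleared, provided that [f] has degree at most [k];
    higher coefficients are dropped. *)
Definition homog (F : fieldType) (k : nat) (f a b : {poly F}) : {poly F} :=
  \sum_(l < k.+1) f`_l *: (a ^+ l * b ^+ (k - l)).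

Lemma horner_homog (F : fieldType) (k : nat) (f a b : {poly F}) (x : F) :
  (size f <= k.+1)%N -> b.[x] != 0 ->
  (homog k f a b).[x] = b.[x] ^+ k * f.[a.[x] / b.[x]].
Proof.
move=> sf bx0; rewrite horner_sum (horner_coef_wide _ sf) mulr_sumr.
apply: eq_bigr => l _; rewrite !hornerE expr_div_n.
have -> : b.[x] ^+ k = b.[x] ^+ (k - l) * b.[x] ^+ l.
  by rewrite -exprD subnK // -ltnS ltn_ord.
have bl0 : b.[x] ^+ l != 0 by rewrite expf_neq0.
move: (_ ^+ (k - l)) (b.[x] ^+ l) bl0 (a.[x] ^+ l) => y y' y0 y'' /=.
by field.
Qed.

Lemma size_homog (F : fieldType) (k : nat) (f a b : {poly F}) :
  (size a <= 2)%N -> (size b <= 2)%N -> (size (homog k f a b) <= k.+1)%N.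
Proof.
move=> sa sb; apply: leq_trans (size_sum _ _ _) _; apply/bigmax_leqP => l _.
apply: leq_trans (size_scale_leq _ _) _; apply: leq_trans (size_polyMleq _ _) _.
have la := size_poly_exp_leq a l; have lb := size_poly_exp_leq b (k - l).
have lk : (l <= k)%N by rewrite -ltnS ltn_ord.
have la' : (size (a ^+ l)%R <= l.+1)%N.
  by apply: leq_trans la _; rewrite ltnS -[leqRHS]mul1n leq_mul2r; lia.
have lb' : (size (b ^+ (k - l))%R <= (k - l).+1)%N.
  by apply: leq_trans lb _; rewrite ltnS -[leqRHS]mul1n leq_mul2r; lia.
move: la' lb' lk; lia.
Qed.

(** At a real point, the real and imaginary parts of the coefficients give those of the value. *)
Lemma normc2_horner_real (R : rcfType) (H : {poly R[i]}) :
  exists A B : {poly R}, [/\ (size A <= size H)%N, (size B <= size H)%N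
    & forall u : R, `|H.[u%:C]| ^+ 2 = (A.[u] ^+ 2 + B.[u] ^+ 2)%:C].
Proof.
exists (\poly_(l < size H) complex.Re H`_l), (\poly_(l < size H) complex.Im H`_l).
split; try exact: size_poly.
move=> u; have -> : H.[u%:C] =
    (\poly_(l < size H) complex.Re H`_l).[u] +i* (\poly_(l < size H) complex.Im H`_l).[u].
  rewrite horner_coef !horner_poly [RHS]complexE !rmorph_sum mulr_sumr -big_split /=.
  apply: eq_bigr => l _; rewrite {1}[H`_l]complexE !rmorphM /= !rmorphXn /=; ring.
by rewrite sqr_normc /=; apply/eqP; rewrite eq_complex /=; apply/andP; split;
  apply/eqP; ring.
Qed.

Lemma size_affine_poly (F : nzRingType) (c d : F) :
  (size (c%:P + d *: 'X)%R <= 2)%N.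
Proof.
apply: leq_trans (size_polyD _ _) _; rewrite geq_max.
apply/andP; split; first exact: leq_trans (size_polyC_leq1 _) _.
by apply: leq_trans (size_scale_leq _ _) _; rewrite size_polyX.
Qed.

(** * Moebius parametrization of an arc by the half-line *)

Section Moebius.
Variables (R : rcfType) (al be : R).
Hypothesis al_lt_be : al < be.

Let w (u : R) : R[i] := (1 + u) +i* (al + be * u).

(** For [u >= 0] the arc is half-open: the end belonging to [be] is only the limit as [u] tends to
    infinity. *)
Definition arc_point (u : R) : R[i] := (w u)^*%C / w u.
Definition arc_norm2 (u : R) : R := (1 + u) ^+ 2 + (al + be * u) ^+ 2.

Let z0 : R[i] := 1 +i* al.
Let z1 : R[i] := 1 +i* be.
Let wE u : w u = z0 + z1 * u%:C.
Proof.
rewrite /w /z0 /z1; apply/eqP; rewrite eq_complex /=.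
by apply/andP; split; apply/eqP; ring.
Qed.
Let wcE u : (w u)^*%C = z0^*%C + z1^*%C * u%:C.
Proof.
rewrite /w /z0 /z1; apply/eqP; rewrite eq_complex /=.
by apply/andP; split; apply/eqP; ring.
Qed.

Let w_neq0 u : w u != 0.
Proof.
rewrite /w eq_complex /=; apply/negP => /andP[/eqP h1 /eqP h2].
have uE : u = -1 by apply/eqP; rewrite -addr_eq0 addrC h1.
by move/eqP: h2; rewrite uE mulrN1 subr_eq0 lt_eqF.
Qed.

Lemma arc_norm2E u : (arc_norm2 u)%:C = `|w u| ^+ 2.
Proof.
rewrite sqr_normc /w /arc_norm2 /=; apply/eqP; rewrite eq_complex /=.
by apply/andP; split; apply/eqP; ring.
Qed.

(** Determinant of [w] and its conjugate as affine functions of [u]; it equals [2 i (be - al)]. *)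
Let kappa := z1 * z0^*%C - z0 * z1^*%C.
Let kappa_neq0 : kappa != 0.
Proof.
rewrite /kappa /z0 /z1 eq_complex /= negb_and; apply/orP; right.
rewrite (_ : _ + _ = 2 * (be - al)); last by ring.
by rewrite mulf_neq0 ?pnatr_eq0 // subr_eq0 gt_eqF.
Qed.

(* The factor [w u / w u ^+ M], instead of [w u ^- M.-1], also covers [M = 0],
   where [F = 0]. *)
Let unhomog (M : nat) (F : {poly R}) : (size F <= M)%N ->
  exists f : {poly R[i]}, (size f <= M)%N /\
    forall u, f.[arc_point u] = (F.[u])%:C * w u / w u ^+ M.
Proof.
case: M => [|N] sF.
  exists 0; split; first by rewrite size_poly0.
  move=> u; move: sF; rewrite leqn0 size_poly_eq0 => /eqP ->.
  by rewrite !horner0 !mul0r.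
(* These invert the parametrization: at [arc_point u] they take the values [kappa u / w u] and
   [kappa / w u], with quotient [u]. *)
pose a := (z0^*%C)%:P + (- z0) *: 'X; pose b := (- z1^*%C)%:P + z1 *: 'X.
exists (kappa ^- N *: homog N (map_poly (real_complex R) F) a b); split.
  apply: leq_trans (size_scale_leq _ _) _; apply: size_homog; exact: size_affine_poly.
move=> u; have bE : b.[arc_point u] = kappa / w u.
  rewrite /b /arc_point !hornerE wcE /kappa; move: (w_neq0 u); rewrite wE /=.
  by move: (z0^*%C) (z1^*%C) (u%:C) => c0 c1 v; clearbody z0 z1 => wn; field.
have aE : a.[arc_point u] = u%:C * kappa / w u.
  rewrite /a /arc_point !hornerE wcE /kappa; move: (w_neq0 u); rewrite wE /=.
  by move: (z0^*%C) (z1^*%C) (u%:C) => c0 c1 v; clearbody z0 z1 => wn; field.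
rewrite hornerZ horner_homog ?size_map_poly // bE ?mulf_neq0 ?invr_eq0 //.
have -> : a.[arc_point u] / (kappa / w u) = u%:C.
  by rewrite aE; field; rewrite kappa_neq0 w_neq0.
rewrite horner_map /= expr_div_n exprS; field.
by rewrite !expf_neq0 ?w_neq0 ?kappa_neq0.
Qed.

Lemma arc_point_norm u : `|arc_point u| = 1.
Proof. by rewrite /arc_point normf_div normcJ divff // normr_eq0. Qed.

(** Cross-multiplying leaves an equation linear in [u - v] with factor [be - al]. This supplies
    infinitely many points at which to compare polynomials. *)
Lemma arc_point_inj : injective arc_point.
Proof.
move=> u v /eqP; rewrite /arc_point eqr_div // => /eqP/(congr1 (@complex.Im R)) /= h.
apply: (mulfI (_ : (be - al) != 0)); first by rewrite subr_eq0 gt_eqF.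
by apply/eqP; rewrite -subr_eq0; apply/eqP; lra.
Qed.

Lemma arc_certificate (N : nat) (q : {poly R[i]}) :
  (size q <= N.+1)%N -> (forall u, 0 <= u -> `|q.[arc_point u]| <= 1) ->
  exists f1 f2 g1 g2 : {poly R[i]},
  [/\ (size f1 <= N.+1)%N /\ (size f2 <= N.+1)%N,
      (size g1 <= N)%N /\ (size g2 <= N)%N
    & forall u, 0 <= u -> let z := arc_point u in
        1 - `|q.[z]| ^+ 2 = `|f1.[z]| ^+ 2 + `|f2.[z]| ^+ 2
          + ((be - al) ^+ 2 * u / arc_norm2 u)%:C
            * (`|g1.[z]| ^+ 2 + `|g2.[z]| ^+ 2)].
Proof.
move=> sq q_le1.
pose H := homog N q ((z0^*%C)%:P + z1^*%C *: 'X) (z0%:P + z1 *: 'X).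
have HE u : H.[u%:C] = w u ^+ N * q.[arc_point u].
  by rewrite /H horner_homog ?hornerE // -?wE // -wcE.
have sH : (size H <= N.+1)%N by apply: size_homog; apply: size_affine_poly.
have [A [B [sA sB ABE]]] := normc2_horner_real H.
pose W : {poly R} := (1 + 'X) ^+ 2 + (al%:P + be *: 'X) ^+ 2.
pose p := W ^+ N - (A ^+ 2 + B ^+ 2).
have pE u : (p.[u])%:C = `|w u| ^+ 2 ^+ N * (1 - `|q.[arc_point u]| ^+ 2).
  rewrite /p hornerD hornerN [in X in _ - X]hornerD !horner_exp rmorphB /= -ABE HE.
  rewrite rmorphXn /= normrM normrX exprMn -!exprM [(N * 2)%N]mulnC.
  rewrite (_ : W.[u] = arc_norm2 u); last by rewrite /W /arc_norm2 !hornerE.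
  by rewrite arc_norm2E -exprM; ring.
have p_ge0 u : 0 <= u -> 0 <= p.[u].
  move=> u0; rewrite -lecR pE mulr_ge0 ?exprn_ge0 // subr_ge0.
  by rewrite expr_le1 ?q_le1.
have size_sq (F : {poly R}) k : (size F <= k.+1)%N -> (size (F ^+ 2)%R <= k.*2.+1)%N.
  move=> sF; apply: leq_trans (size_poly_exp_leq _ _) _.
  by rewrite muln2 ltnS leq_double; lia.
have sW : (size W <= 3)%N.
  apply: leq_trans (size_polyD _ _) _; rewrite geq_max.
  apply/andP; split; apply: (size_sq _ 1) => //; last exact: size_affine_poly.
  by have := size_affine_poly (1 : R) 1; rewrite scale1r.
have sp : (size p <= N.*2.+1)%N.
  apply: leq_trans (size_polyD _ _) _; rewrite size_polyN geq_max.
  apply/andP; split.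
    apply: leq_trans (size_poly_exp_leq _ _) _.
    by rewrite ltnS -muln2 mulnC leq_mul2l; lia.
  apply: leq_trans (size_polyD _ _) _; rewrite geq_max.
  by rewrite !size_sq // (leq_trans _ sH).
have [F1 [F2 [G1 [G2 [[sF1 sF2] [sG1 sG2] FGE]]]]] := nonneg_poly_halfline sp p_ge0.
have [f1 [sf1 f1E]] := unhomog sF1.
have [f2 [sf2 f2E]] := unhomog sF2.
have [g1 [sg1 g1E]] := unhomog sG1.
have [g2 [sg2 g2E]] := unhomog sG2.
pose d := (be - al)%:C.
have d_neq0 : d != 0 by rewrite fmorph_eq0 subr_eq0 gt_eqF.
exists f1, f2, (d^-1 *: g1), (d^-1 *: g2).
split; [by []|by split; apply: leq_trans (size_scale_leq _ _) _|].
move=> u u0 /=; rewrite !hornerZ f1E f2E g1E g2E.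
have wn0 : `|w u| != 0 by rewrite normr_eq0.
have wN0 : `|w u| ^+ N != 0 by rewrite expf_neq0.
have -> : 1 - `|q.[arc_point u]| ^+ 2 = (p.[u])%:C / (`|w u| ^+ N) ^+ 2.
  by rewrite pE -!exprM mulnC mulrAC divff ?mul1r // expf_neq0.
have nd : `|d| ^+ 2 = d ^+ 2 by rewrite sqr_normc conjc_real expr2.
have nF (F : {poly R}) : `|(F.[u])%:C| ^+ 2 = (F.[u])%:C ^+ 2.
  by rewrite sqr_normc conjc_real expr2.
have -> : ((be - al) ^+ 2 * u / arc_norm2 u)%:C = d ^+ 2 * u%:C / `|w u| ^+ 2.
  by rewrite rmorphM /= fmorphV /= arc_norm2E rmorphM /= rmorphXn.
rewrite FGE // [in LHS]rmorphD /= rmorphM /= !rmorphD /= !rmorphXn /=.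
rewrite !(normrM, normrX, normfV) (exprS `|w u| N) !exprMn !exprVn nd !nF.
have := wN0; move: (`|w u| ^+ N) => y y_neq0.
rewrite !exprMn; clearbody d; field.
by rewrite wn0 y_neq0 d_neq0.
Qed.

End Moebius.

(** * Positive semidefinite matrices and their diagonal sums *)

Section PositiveMatrices.
Variable R : realType.
Local Notation C := R[i].

Lemma adjmxM m n p (A : 'M[C]_(m, n)) (B : 'M[C]_(n, p)) :
  (A *m B)^t* = B^t* *m A^t*.
Proof. by rewrite trmx_mul map_mxM. Qed.

Lemma hermsymmxE n (A : 'M[C]_n) : (A \is hermsymmx) = (A == A^t*).
Proof. by rewrite is_hermitianmxE expr0 scale1r. Qed.

Definition quad n (A : 'M[C]_n) (v : 'cV[C]_n) : C := (v^t* *m A *m v) 0 0.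

Lemma quadD n (A B : 'M[C]_n) v : quad (A + B) v = quad A v + quad B v.
Proof. by rewrite /quad mulmxDr mulmxDl mxE. Qed.

Lemma quad_outer n (f v : 'cV[C]_n) :
  quad (f *m f^t*) v = `|(f^t* *m v) 0 0| ^+ 2.
Proof.
rewrite /quad mulmxA -mulmxA -{1}[v^t* *m f]trmxCK adjmxM trmxCK.
by rewrite mxE big_ord1 !mxE normCKC.
Qed.

Lemma psdmx_outer n (f : 'cV[C]_n) : psdmx (f *m f^t*).
Proof.
split; first by rewrite hermsymmxE adjmxM trmxCK.
by move=> v; rewrite -/(quad _ v) quad_outer exprn_ge0.
Qed.

Lemma psdmxD n (A B : 'M[C]_n) : psdmx A -> psdmx B -> psdmx (A + B).
Proof.
move=> [hA pA] [hB pB]; split => [|v].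
  move: hA hB; rewrite !hermsymmxE => /eqP hA /eqP hB.
  by rewrite linearD map_mxD /= -hA -hB.
by rewrite -/(quad _ v) quadD addr_ge0 ?pA ?pB.
Qed.

(** Testing the block form on the vector [(v, - q^* v)] leaves [quad A v - |q^* v|^2]. *)
Lemma psdmx_schur n (A : 'M[C]_n) (q v : 'cV[C]_n) :
  psdmx (block_mx A q (q^t*) 1%:M) -> `|(q^t* *m v) 0 0| ^+ 2 <= quad A v.
Proof.
move=> [_ /(_ (col_mx v (- (q^t* *m v))))].
set s := q^t* *m v.
have -> : (col_mx v (- s))^t* = row_mx (v^t*) (- s^t*).
  by rewrite tr_col_mx map_row_mx linearN map_mxN.
rewrite mul_row_block mul_row_col mulmx1.
have -> : v^t* *m q = s^t* by rewrite adjmxM trmxCK.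
rewrite subrr mul0mx addr0 mulmxDl !mulNmx -[s^t* *m _ *m v]mulmxA -/s.
have sE : (s^t* *m s) 0 0 = `|s 0 0| ^+ 2 by rewrite mxE big_ord1 !mxE normCKC.
by rewrite [X in 0 <= X -> _]mxE [X in _ + X]mxE sE subr_ge0.
Qed.

(** The block matrix is the sum of the rank-one matrices of [(q, 1)], [(f1, 0)] and [(f2, 0)]. *)
Lemma psdmx_block n (q f1 f2 : 'cV[C]_n) :
  psdmx (block_mx (q *m q^t* + (f1 *m f1^t* + f2 *m f2^t*)) q (q^t*) 1%:M).
Proof.
have col0 (f : 'cV[C]_n) : col_mx f (0 : 'M[C]_1) *m (col_mx f (0 : 'M[C]_1))^t* =
    block_mx (f *m f^t*) 0 0 0.
  by rewrite tr_col_mx map_row_mx mul_col_row linear0 map_mx0 mulmx0 !mul0mx.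
have -> : block_mx (q *m q^t* + (f1 *m f1^t* + f2 *m f2^t*)) q (q^t*) 1%:M =
    col_mx q 1%:M *m (col_mx q 1%:M)^t*
    + col_mx f1 (0 : 'M[C]_1) *m (col_mx f1 (0 : 'M[C]_1))^t*
    + col_mx f2 (0 : 'M[C]_1) *m (col_mx f2 (0 : 'M[C]_1))^t*.
  rewrite !col0 tr_col_mx map_row_mx mul_col_row trmx1 map_mx1 mulmx1 !mul1mx.
  by rewrite !add_block_mx !addr0 addrA.
by apply: psdmxD; [apply: psdmxD|]; apply: psdmx_outer.
Qed.

End PositiveMatrices.

(** * Diagonal sums as coefficients of trigonometric polynomials *)

Section TraceParametrization.
Variable R : realType.
Local Notation C := R[i].

Lemma tr_Theta n (k : int) (Q : 'M[C]_n) :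
  \tr (Theta R n k *m Q) =
  \sum_(i < n) \sum_(j < n) ((j : nat)%:Z - (i : nat)%:Z == k)%:R * Q j i.
Proof.
by apply: eq_bigr => i _; rewrite mxE; apply: eq_bigr => j _; rewrite mxE.
Qed.

(** Each entry of [Q] lies on exactly one diagonal. The shift [c] makes all exponents natural
    numbers, and the hypothesis says that the window of length [K] meets every diagonal. *)
Lemma sum_tr_Theta n (K : nat) (Q : 'M[C]_n) (c : int) (z : C) : z != 0 ->
  (forall i j : 'I_n, 0 <= (j : nat)%:Z - (i : nat)%:Z + c < K%:Z) ->
  \sum_(m < K) \tr (Theta R n ((m : nat)%:Z - c) *m Q) * z ^+ m =
  z ^ c * \sum_(i < n) \sum_(j < n) Q j i * z ^ ((j : nat)%:Z - (i : nat)%:Z).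
Proof.
move=> z0 hc; under eq_bigr => m _ do rewrite tr_Theta mulr_suml.
rewrite exchange_big mulr_sumr /=; apply: eq_bigr => i _.
under eq_bigr => m _ do rewrite mulr_suml.
rewrite exchange_big mulr_sumr /=; apply: eq_bigr => j _.
have /andP[c0 cK] := hc i j.
have m0P : (absz ((j : nat)%:Z - (i : nat)%:Z + c)%R < K)%N by lia.
rewrite (bigD1 (Ordinal m0P)) //= big1 => [|m /eqP m_neq]; last first.
  rewrite (_ : (_ == _) = false) ?mul0r //; apply/negP => /eqP h.
  by apply: m_neq; apply/val_inj => /=; lia.
rewrite (_ : (_ == _) = true) ?mul1r ?addr0; last by apply/eqP; lia.
rewrite mulrCA -expfzDr // exprnP /=; congr (_ * z ^ _); lia.
Qed.

(** The conjugate makes the entry [Q j i] come with [z^(j - i)], in agreement with [Theta]. *)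
Definition evec n (z : C) : 'cV[C]_n := \col_i (z^*%C ^+ i).

Lemma quad_evec n (Q : 'M[C]_n) (z : C) : `|z| = 1 ->
  quad Q (evec n z) =
  \sum_(i < n) \sum_(j < n) Q j i * z ^ ((j : nat)%:Z - (i : nat)%:Z).
Proof.
move=> z1; have z0 : z != 0 by rewrite -normr_eq0 z1 oner_eq0.
have zc : z^*%C = z^-1 by rewrite invc_norm z1 expr1n invr1 mul1r.
rewrite /quad mxE; apply: eq_bigr => i _; rewrite mxE mulr_suml.
apply: eq_bigr => j _; rewrite !mxE rmorphXn /= (conjcK z : Num.conj (z^*%C) = z).
by rewrite expfzDr // -invr_expz zc exprVn -!exprnP; ring.
Qed.

Definition col_poly n (q : 'cV[C]_n) : {poly C} := rVpoly q^T.

Lemma horner_col_poly n (q : 'cV[C]_n) z :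
  (col_poly q).[z] = \sum_(l < n) q l 0 * z ^+ l.
Proof.
rewrite (@horner_coef_wide _ n) ?size_poly //.
by apply: eq_bigr => l _; rewrite coef_rVpoly_ord mxE.
Qed.

Lemma norm_adj_evec n (q : 'cV[C]_n) z :
  `|(q^t* *m evec n z) 0 0| = `|(col_poly q).[z]|.
Proof.
rewrite horner_col_poly -[RHS]normcJ rmorph_sum mxE; congr `|_|.
by apply: eq_bigr => l _; rewrite !mxE rmorphM rmorphXn.
Qed.

Variables (N : nat) (fL fH : R).

(** At [z = exp(- i w)] this is [D(w)]. *)
Definition band_weight (z : C) : C :=
  d1 fL fH * z + d0 fL fH + (d1 fL fH)^*%C * z^*%C.

Lemma calLE (k : int) (Q1 : 'M[C]_N.+1) (Q2 : 'M[C]_N) :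
  calL k fL fH Q1 Q2 = \tr (Theta R N.+1 k *m Q1)
    + (d1 fL fH * \tr (Theta R N (k - 1) *m Q2)
       + d0 fL fH * \tr (Theta R N k *m Q2)
       + (d1 fL fH)^*%C * \tr (Theta R N (k + 1) *m Q2)).
Proof.
rewrite /calL; move: (d1 fL fH) (d0 fL fH) => a b.
by rewrite [in LHS]mulmxDl [in LHS]mulmxDl -!scalemxAl !mxtraceD !mxtraceZ.
Qed.

Lemma sum_calL (Q1 : 'M[C]_N.+1) (Q2 : 'M[C]_N) (z : C) : `|z| = 1 ->
  \sum_(m < N.*2.+1) calL ((m : nat)%:Z - N%:Z) fL fH Q1 Q2 * z ^+ m =
  z ^+ N * (quad Q1 (evec _ z) + band_weight z * quad Q2 (evec _ z)).
Proof.
move=> z1; have z0 : z != 0 by rewrite -normr_eq0 z1 oner_eq0.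
have zc : z^*%C = z^-1 by rewrite invc_norm z1 expr1n invr1 mul1r.
(* The diagonals [k - 1], [k], [k + 1] become windows shifted by [N + 1], [N], [N - 1]; the
   resulting factors [z], [1], [1 / z] next to [z^N] assemble into [band_weight z]. *)
transitivity (
  \sum_(m < N.*2.+1) \tr (Theta R N.+1 ((m : nat)%:Z - N%:Z) *m Q1) * z ^+ m
  + (d1 fL fH * \sum_(m < N.*2.+1)
      \tr (Theta R N ((m : nat)%:Z - N.+1%:Z) *m Q2) * z ^+ m
  + d0 fL fH * \sum_(m < N.*2.+1) \tr (Theta R N ((m : nat)%:Z - N%:Z) *m Q2) * z ^+ m
  + (d1 fL fH)^*%C * \sum_(m < N.*2.+1)
      \tr (Theta R N ((m : nat)%:Z - (N%:Z - 1)) *m Q2) * z ^+ m)).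
  rewrite !mulr_sumr -!big_split; apply: eq_bigr => m _.
  rewrite calLE; move: (d1 fL fH) (d0 fL fH) => a b.
  have -> : (m : nat)%:Z - N%:Z - 1 = (m : nat)%:Z - N.+1%:Z by lia.
  have -> : (m : nat)%:Z - N%:Z + 1 = (m : nat)%:Z - (N%:Z - 1) by lia.
  by move: (a^*%C) => a'; rewrite /=; ring.
rewrite !sum_tr_Theta -?quad_evec //;
  try by move=> i j; have := ltn_ord i; have := ltn_ord j; lia.
rewrite expfzDr // exprN1 -!exprnP exprS /band_weight zc.
move: (d1 fL fH) (d0 fL fH) => a b; move: (a^*%C) => a'; ring.
Qed.

Lemma conj_tr_Theta n (k : int) (Q : 'M[C]_n) : Q \is hermsymmx ->
  (\tr (Theta R n k *m Q))^*%C = \tr (Theta R n (- k) *m Q).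
Proof.
rewrite hermsymmxE => /eqP hQ; rewrite !tr_Theta rmorph_sum exchange_big /=.
rewrite exchange_big /=.
under eq_bigr => i _ do rewrite rmorph_sum.
rewrite exchange_big /=; apply: eq_bigr => i _; apply: eq_bigr => j _.
rewrite rmorphM rmorph_nat {2}hQ !mxE; congr (_%:R * _).
by apply/eqP/eqP; lia.
Qed.

(** The semidefinite constraints prescribe only [k >= 0]; this symmetry yields the negative
    indices. *)
Lemma conj_calL (k : int) (Q1 : 'M[C]_N.+1) (Q2 : 'M[C]_N) :
  Q1 \is hermsymmx -> Q2 \is hermsymmx ->
  (calL k fL fH Q1 Q2)^*%C = calL (- k) fL fH Q1 Q2.
Proof.
move=> h1 h2; rewrite !calLE.
have : (d0 fL fH)^*%C = d0 fL fH by rewrite conjc_real.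
move: (d1 fL fH) (d0 fL fH) => a b hb.
rewrite !rmorphD /= [X in _ + (X + _ + _)]rmorphM [X in _ + (_ + X + _)]rmorphM.
rewrite [X in _ + (_ + _ + X)]rmorphM /= !conj_tr_Theta // conjcK hb.
have -> : - (k - 1) = - k + 1 by lia.
have -> : - (k + 1) = - k - 1 by lia.
move: (a^*%C) => a'; rewrite /=; ring.
Qed.

(** Among the coefficients in [sum_calL] only the one of [z^N] survives, and it is 1. *)
Lemma band_sdp_identity (q : 'cV[C]_N.+1) Q1 Q2 (z : C) :
  band_sdp fL fH q Q1 Q2 -> `|z| = 1 ->
  1 = quad Q1 (evec _ z) + band_weight z * quad Q2 (evec _ z).
Proof.
move=> [[h1 _] [h2 _] hL _] z1.
have z0 : z != 0 by rewrite -normr_eq0 z1 oner_eq0.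
have hN : (N < N.*2.+1)%N by lia.
have L0 : calL 0 fL fH Q1 Q2 = 1 by rewrite -[0]/(Posz 0) -(hL 0%N).
have LS k : (0 < k <= N)%N -> calL k%:Z fL fH Q1 Q2 = 0.
  by move=> /andP[k0 kN]; rewrite -(hL k) // eqn0Ngt k0.
apply: (mulfI (expf_neq0 N z0)); rewrite mulr1 -sum_calL //.
rewrite (bigD1 (Ordinal hN)) //= subrr L0 mul1r big1 ?addr0 // => m /eqP m_neq.
have {}m_neq : (m : nat) <> N by move=> h; apply: m_neq; apply/val_inj.
have mlt := ltn_ord m.
have [leNm|ltmN] := leqP N m.
  have -> : (m : nat)%:Z - N%:Z = (m - N)%:Z by lia.
  by rewrite LS ?mul0r //; lia.
have -> : (m : nat)%:Z - N%:Z = - (N - m)%:Z by lia.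
by rewrite -conj_calL // LS ?conjc0 ?mul0r //; lia.
Qed.

Lemma poly_eq0_inj_roots (F : idomainType) (P : {poly F}) (zs : nat -> F) :
  injective zs -> (forall k, P.[zs k] = 0) -> P = 0.
Proof.
move=> zs_inj P0; apply: contraTeq isT => Pn0.
have := @max_poly_roots _ P (map zs (iota 0 (size P))) Pn0.
rewrite map_inj_uniq // iota_uniq size_map size_iota ltnn => h.
by apply: h => //; apply/allP => _ /mapP[k _ ->]; apply/rootP.
Qed.

(** The generating polynomial of the diagonal sums agrees with [X^N] at infinitely many points,
    hence everywhere; its coefficient of index [k + N] is the constraint of index [k]. *)
Lemma band_sdp_squares (q f1 f2 : 'cV[C]_N.+1) (g1 g2 : 'cV[C]_N) (zs : nat -> C) :
  injective zs -> (forall k, `|zs k| = 1) ->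
  (forall k, let z := zs k in
     1 - `|(col_poly q).[z]| ^+ 2 =
       `|(col_poly f1).[z]| ^+ 2 + `|(col_poly f2).[z]| ^+ 2
       + band_weight z * (`|(col_poly g1).[z]| ^+ 2 + `|(col_poly g2).[z]| ^+ 2)) ->
  band_sdp fL fH q (q *m q^t* + (f1 *m f1^t* + f2 *m f2^t*))
    (g1 *m g1^t* + g2 *m g2^t*).
Proof.
move=> zs_inj zs1 hz; set Q1 := _ + _; set Q2 := _ + _.
have pQ2 : psdmx Q2 by apply: psdmxD; apply: psdmx_outer.
have pQ1 : psdmx Q1 by apply: psdmxD; [|apply: psdmxD]; apply: psdmx_outer.
split => //; last exact: psdmx_block.
pose P := \poly_(m < N.*2.+1) calL (m%:Z - N%:Z) fL fH Q1 Q2 - 'X^N.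
have P0 : P = 0.
  apply: (poly_eq0_inj_roots zs_inj) => k.
  rewrite /P hornerD hornerN hornerXn horner_poly sum_calL //.
  rewrite /Q1 /Q2 !quadD !quad_outer !norm_adj_evec.
  by rewrite -addrA -hz addrC subrK mulr1 subrr.
move=> k kN.
have := congr1 (fun p : {poly C} => p`_(k + N)) P0.
rewrite /P coefB coef_poly coefXn coef0.
rewrite (_ : (k + N == N)%N = (k == 0)%N); last by apply/eqP/eqP; lia.
rewrite (_ : (k + N < N.*2.+1)%N); last by lia.
move/eqP; rewrite subr_eq0 => /eqP <-; congr (calL _ _ _ _ _); lia.
Qed.

End TraceParametrization.

(** * Frequency bands *)

Section BandAngles.
Variable R : realType.
Local Notation C := R[i].

Lemma cisD (s t : R) : cis (s + t) = cis s * cis t.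
Proof.
rewrite /cis cosD sinD; apply/eqP; rewrite eq_complex /= eqxx /=.
by apply/eqP; rewrite addrC mulrC [sin s * _]mulrC; ring.
Qed.

Lemma cis_mulrn (t : R) (l : nat) : cis (t * l%:R) = cis t ^+ l.
Proof.
elim: l => [|l IH]; first by rewrite mulr0 /cis cos0 sin0 expr0.
by rewrite -natr1 mulrDr mulr1 cisD IH exprSr.
Qed.

Lemma conj_cis (t : R) : (cis t)^*%C = cis (- t).
Proof. by rewrite /cis cosN sinN. Qed.

Lemma norm_cis (t : R) : `|cis t| = 1.
Proof.
apply/eqP; rewrite -sqrp_eq1 // sqr_normc conj_cis -cisD subrr.
by rewrite /cis cos0 sin0.
Qed.

Lemma cisD2pi (t : R) : cis (t + 2 * pi) = cis t.
Proof. by rewrite /cis mulr_natl cosD2pi sinD2pi. Qed.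

Lemma trig_polyE n (q : 'cV[C]_n) (f : R) :
  trig_poly q f = (col_poly q).[cis (- (2 * pi * f))].
Proof.
rewrite horner_col_poly; apply: eq_bigr => l _.
by rewrite -cis_mulrn; congr (_ * cis _); ring.
Qed.

(* The shift is 0 below 1/2 and 1 above, so that [omega f = 2 pi (f - e)] on the
   whole band. *)
Lemma band_half_angles (fL fH : R) : 0 <= fL -> fL < fH -> fH <= 1 ->
  ~ (fL <= 1 / 2 <= fH) ->
  exists e : R, [/\ omega fL / 2 = pi * (fL - e), omega fH / 2 = pi * (fH - e),
    - (1 / 2) < fL - e, fH - e < 1 / 2
    & forall t : R, cis (- (2 * pi * t)) = cis (- (2 * (pi * (t - e))))].
Proof.
move=> fL0 fLH fH1 nhalf; have [hH|hH] := ltP fH (1 / 2).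
  exists 0; split; rewrite ?subr0 //; try lra.
  - by rewrite /omega ifT; [field|lra].
  - by rewrite /omega ifT; [field|lra].
  - by move=> t; congr cis; ring.
have hL : 1 / 2 < fL by rewrite ltNge; apply/negP => hL; apply: nhalf; rewrite hL hH.
exists 1; split; try lra.
- by rewrite /omega ifF; [field|apply/negbTE; rewrite -ltNge].
- by rewrite /omega ifF; [field|apply/negbTE; rewrite -ltNge; lra].
- move=> t; rewrite -(cisD2pi (- (2 * pi * t))); congr cis; ring.
Qed.

(** Multiplying the constant term by [cos^2 + sin^2] makes the weight a quadratic form in
    [(cos h, sin h)], which splits into two linear factors vanishing in the directions of slopes
    [tan (omega fL / 2)] and [tan (omega fH / 2)]. *)
Lemma band_weight_cis (fL fH h : R) :
  band_weight fL fH (cis (- (2 * h))) =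
  ((sin h - tan (omega fL / 2) * cos h)
   * (tan (omega fH / 2) * cos h - sin h))%:C.
Proof.
rewrite /band_weight /d1 /d0; cbv zeta.
move: (tan (omega fL / 2)) (tan (omega fH / 2)) => al be.
have -> : - (2 * h) = - (h + h) by ring.
rewrite /cis cosN sinN cosD sinD.
have := cos2Dsin2 h; move: (cos h) (sin h) => x y xy.
have E : (al * be + 1) / 2 = (al * be + 1) / 2 * (x ^+ 2 + y ^+ 2).
  by rewrite xy mulr1.
rewrite {}E; apply/eqP; rewrite eq_complex /=.
by apply/andP; split; apply/eqP; field.
Qed.

Lemma sin_sub_tan (a h : R) : cos a != 0 ->
  sin h - tan a * cos h = sin (h - a) / cos a.
Proof. by move=> a0; rewrite /tan sinB; field. Qed.

(** The two factors are [sin (h - a) / cos a] and [sin (b - h) / cos b], with both sine arguments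
    between 0 and [pi]. *)
Lemma band_weight_ge0 (fL fH h : R) :
  let a := omega fL / 2 in let b := omega fH / 2 in
  - (pi / 2) < a -> b < pi / 2 -> a <= h <= b ->
  0 <= band_weight fL fH (cis (- (2 * h))).
Proof.
move=> a b ha hb /andP[ah hb']; rewrite band_weight_cis -/a -/b lecR.
have ca : 0 < cos a by rewrite cos_gt0_pihalf // ha /=; lra.
have cb : 0 < cos b by rewrite cos_gt0_pihalf // hb andbT; lra.
rewrite mulr_ge0 //.
  rewrite sin_sub_tan ?gt_eqF // divr_ge0 ?(ltW ca) // sin_ge0_pi //.
  by apply/andP; split; lra.
rewrite -opprB sin_sub_tan ?gt_eqF // -mulNr -sinN opprB divr_ge0 ?(ltW cb) //.
by rewrite sin_ge0_pi //; apply/andP; split; lra.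
Qed.

(** The angle is [atan t], where [t] is the mean of [tan a] and [tan b] with weights 1 and [u];
    monotonicity of [atan] puts it between [a] and [b]. *)
Lemma arc_point_angle (fL fH u : R) :
  let a := omega fL / 2 in let b := omega fH / 2 in
  - (pi / 2) < a -> a < b -> b < pi / 2 -> 0 <= u ->
  exists h : R, [/\ a <= h <= b, arc_point (tan a) (tan b) u = cis (- (2 * h))
    & band_weight fL fH (cis (- (2 * h))) =
      ((tan b - tan a) ^+ 2 * u / arc_norm2 (tan a) (tan b) u)%:C].
Proof.
move=> a b ha ab hb u0.
have inI (x : R) : - (pi / 2) < x -> x < pi / 2 -> x \in `](- (pi / 2)), (pi / 2)[.
  by move=> x1 x2; rewrite in_itv /= x1 x2.
have Ia : a \in `](- (pi / 2)), (pi / 2)[ by apply: inI; lra.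
have Ib : b \in `](- (pi / 2)), (pi / 2)[ by apply: inI; lra.
have tab : tan a < tan b by rewrite ltr_tan.
have u1 : 0 < 1 + u by lra.
pose t := (tan a + tan b * u) / (1 + u).
have tE : tan a + tan b * u = t * (1 + u) by rewrite /t; field; lra.
have c0 : cos (atan t) != 0.
  by rewrite gt_eqF // cos_gt0_pihalf // atan_gtNpi2 atan_ltpi2.
have sE : sin (atan t) = t * cos (atan t) by rewrite -{2}(atanK t) /tan; field.
exists (atan t); split.
- apply/andP; split.
    by rewrite -(tanK Ia) le_atan // /t ler_pdivlMr //; nra.
  by rewrite -(tanK Ib) le_atan // /t ler_pdivrMr //; nra.
- have -> : - (2 * atan t) = - atan t + - atan t by ring.
  rewrite cisD /arc_point tE.
  (* Polar form of [w u]: its argument is [atan t], and conjugating doubles the angle in the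
     quotient. *)
  have -> : (1 + u) +i* (t * (1 + u)) = ((1 + u) / cos (atan t))%:C * cis (atan t).
    rewrite /cis sE; apply/eqP; rewrite eq_complex /=.
    by apply/andP; split; apply/eqP; field.
  have k0 : ((1 + u) / cos (atan t))%:C != 0.
    by rewrite fmorph_eq0 mulf_neq0 ?invr_eq0 // gt_eqF.
  have cis0 : cis (atan t) != 0 by rewrite -normr_eq0 norm_cis oner_eq0.
  have conjM (k : R) (y : C) : (k%:C * y)^*%C = k%:C * y^*%C.
    by rewrite -{2}(conjc_real k) -rmorphM.
  rewrite conjM conj_cis invfM mulrACA divff // mul1r.
  congr (_ * _); apply: (mulIf cis0).
  by rewrite mulVf // -cisD addNr /cis cos0 sin0.
rewrite band_weight_cis -/a -/b sE; congr (_%:C).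
have cE : cos (atan t) ^+ 2 * (1 + t ^+ 2) = 1.
  by have := cos2Dsin2 (atan t); rewrite sE => cs; rewrite -[RHS]cs; ring.
have t1 : 1 + t ^+ 2 != 0 by rewrite gt_eqF // ltr_wpDr ?sqr_ge0.
have {}cE : cos (atan t) ^+ 2 = (1 + t ^+ 2)^-1.
  by apply: (mulIf t1); rewrite cE mulVf.
transitivity (cos (atan t) ^+ 2 * ((t - tan a) * (tan b - t))); first by ring.
rewrite cE /arc_norm2 tE.
have n0 : (1 + u) ^+ 2 + (t * (1 + u)) ^+ 2 != 0.
  by rewrite gt_eqF // ltr_wpDr ?sqr_ge0 // exprn_gt0.
have -> : t - tan a = (tan b - tan a) * u / (1 + u) by rewrite /t; field; lra.
have -> : tan b - t = (tan b - tan a) / (1 + u) by rewrite /t; field; lra.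
by field; rewrite n0 t1 gt_eqF.
Qed.

Lemma band_boundP n (fL fH : R) (q : 'cV[C]_n) :
  band_bound fL fH q <->
  forall f, fL <= f <= fH -> `|(col_poly q).[cis (- (2 * pi * f))]| <= 1.
Proof.
have nE (z : C) : (ComplexField.Normc.normc z)%:C = `|z| by [].
split=> [hb f fI|hq].
  rewrite -trig_polyE -nE -[1]/(1%:C) lecR -lee_fin; apply: le_trans hb.
  by apply: ereal_sup_ubound; exists f => //=; rewrite in_itv.
apply: ge_ereal_sup => _ [f /= fI <-]; rewrite lee_fin -lecR nE trig_polyE.
by apply: hq; move: fI; rewrite in_itv.
Qed.

Lemma band_bound_sdp n (hn : (0 < n)%N) (fL fH : R) (q : 'cV[C]_n) :
  0 <= fL -> fL < fH -> fH <= 1 -> ~ (fL <= 1 / 2 <= fH) ->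
  band_bound fL fH q <-> exists Q1 Q2, band_sdp fL fH q Q1 Q2.
Proof.
case: n hn q => // N _ q fL0 fLH fH1 nhalf.
have [e [aE bE eL eH cisE]] := band_half_angles fL0 fLH fH1 nhalf.
have pi0 : 0 < pi :> R := pi_gt0 R.
set a := omega fL / 2 in aE; set b := omega fH / 2 in bE.
(* Since 1/2 is outside the band, both half-angles lie strictly between [- pi / 2] and [pi / 2],
   where [tan] is increasing. *)
have ha : - (pi / 2) < a by rewrite aE; nra.
have ab : a < b by rewrite aE bE; nra.
have hb : b < pi / 2 by rewrite bE; nra.
rewrite band_boundP; split=> [hq|[Q1 [Q2 sdp]] f /andP[f1 f2]]; last first.
  set z := cis _; have z1 : `|z| = 1 by exact: norm_cis.
  have [_ [_ pQ2] _ pB] := sdp.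
  have := psdmx_schur (evec _ z) pB; rewrite norm_adj_evec.
  have := band_sdp_identity sdp z1; set w2 := _ * quad Q2 _ => idE le1.
  have w2_ge0 : 0 <= w2.
    rewrite mulr_ge0 //; last exact: pQ2.
    rewrite /z cisE; apply: band_weight_ge0 => //.
    by rewrite -/a -/b aE bE !ler_pM2l //; apply/andP; split; lra.
  rewrite -(expr_le1 (n := 2)) //; apply: (le_trans le1).
  by rewrite idE lerDl.
have Ia : a \in `](- (pi / 2)), (pi / 2)[ by rewrite in_itv /= ha; lra.
have Ib : b \in `](- (pi / 2)), (pi / 2)[ by rewrite in_itv /= hb andbT; lra.
have tab : tan a < tan b by rewrite ltr_tan.
have [|u u0|f1 [f2 [g1 [g2 [[sf1 sf2] [sg1 sg2] certE]]]]] :=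
    @arc_certificate _ _ _ tab N (col_poly q).
- exact: size_poly.
- have [h [/andP[h1 h2] -> _]] := arc_point_angle ha ab hb u0.
  (* The frequency whose shifted half-angle is [h]. *)
  have := hq (h / pi + e); rewrite cisE.
  rewrite (_ : pi * (h / pi + e - e) = h); last by rewrite addrK mulrC divfK // gt_eqF.
  apply; apply/andP; split.
    by rewrite -lerBlDr ler_pdivlMr // mulrC -aE.
  by rewrite -lerBrDr ler_pdivrMr // mulrC -bE.
(* Natural values of the parameter already give infinitely many distinct points of the arc. *)
pose zs (k : nat) := arc_point (tan a) (tan b) k%:R.
have zs_inj : injective zs.
  by move=> k l /(arc_point_inj tab)/eqP; rewrite eqr_nat => /eqP.
have colK k (f : {poly C}) : (size f <= k)%N ->
    col_poly (poly_rV f : 'rV_k)^T = f.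
  by move=> sf; rewrite /col_poly trmxK poly_rV_K.
exists (q *m q^t* + ((poly_rV f1 : 'rV_N.+1)^T *m ((poly_rV f1 : 'rV_N.+1)^T)^t*
  + (poly_rV f2 : 'rV_N.+1)^T *m ((poly_rV f2 : 'rV_N.+1)^T)^t*)),
  ((poly_rV g1 : 'rV_N)^T *m ((poly_rV g1 : 'rV_N)^T)^t*
  + (poly_rV g2 : 'rV_N)^T *m ((poly_rV g2 : 'rV_N)^T)^t*).
apply: (band_sdp_squares zs_inj) => k; first exact: arc_point_norm.
rewrite /= !colK // certE //; congr (_ + _ * _).
by have [h [_ zE wE]] := arc_point_angle ha ab hb (ler0n R k); rewrite /zs zE wE.
Qed.

End BandAngles.

(** * Equivalence of the two programs *)

Theorem mainTheorem1 (R : realType) (n : nat) (hn : (0 < n)%N)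
    (m : nat) (M : {set 'I_n}) (hM : #|M| = m)
    (p : nat) (hp : (0 < p)%N) (fL fH : 'I_p -> R)
    (hband : forall k, [/\ 0 <= fL k, fL k < fH k & fH k <= 1])
    (hdisj : forall j k, j != k ->
       `[fL j, fH j]%classic `&` `[fL k, fH k]%classic = set0 :> set R)
    (hhalf : forall k, ~ (fL k <= 1 / 2 <= fH k))
    (s : nat) (c : 'I_s -> R[i]) (f : 'I_s -> R)
    (hc : forall j, c j != 0) (hf : forall j, in_bands fL fH (f j))
    (x : 'cV[R[i]]_n)
    (hx : forall l, x l 0 = \sum_(j < s) c j * cis (2 * pi * f j * l%:R)) :
  [/\ forall (j : 'I_p) (q : 'cV[R[i]]_n),
        band_bound (fL j) (fH j) q <->
        exists Q1 Q2, band_sdp (fL j) (fH j) q Q1 Q2,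
      forall q : 'cV[R[i]]_n,
        feasibleD M fL fH q <->
        exists Q1 Q2, feasibleS M fL fH (q, Q1, Q2),
      opt_value (feasibleD M fL fH) (fun q => pairing M q x) =
        opt_value (feasibleS M fL fH) (fun u => pairing M u.1.1 x)
    & forall q : 'cV[R[i]]_n,
        maximizer (feasibleD M fL fH) (fun q => pairing M q x) q <->
        exists Q1 Q2,
          maximizer (feasibleS M fL fH) (fun u => pairing M u.1.1 x)
            (q, Q1, Q2)].
Proof.
have bandP j (q : 'cV[R[i]]_n) : band_bound (fL j) (fH j) q <->
    exists Q1 Q2, band_sdp (fL j) (fH j) q Q1 Q2.
  by have [fL0 fLH fH1] := hband j; exact: (band_bound_sdp hn q fL0 fLH fH1 (hhalf j)).
have feasP q : feasibleD M fL fH q <->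
    exists Q1 Q2, feasibleS M fL fH (q, Q1, Q2).
  split=> [[qM hq]|[Q1 [Q2 [qM hq]]]]; last first.
    by split=> // j; apply/bandP; exists (Q1 j), (Q2 j).
  (* Choice collects the matrices of the single bands into families. *)
  have /choice[Q1 hQ1] := fun j => (bandP j q).1 (hq j).
  by have /choice[Q2 hQ2] := hQ1; exists Q1, Q2.
split=> //.
  (* The objective depends on [q] alone, and the feasible set of (D) is the projection of that of
     (S). *)
  rewrite /opt_value; congr ereal_sup; apply/seteqP; split=> y.
    by move=> [q /feasP[Q1 [Q2 hS]] <-]; exists (q, Q1, Q2).
  by move=> [[[q Q1] Q2] hS <-]; exists q => //; apply/feasP; exists Q1, Q2.
move=> q; split=> [[/feasP[Q1 [Q2 hS]] qmax]|[Q1 [Q2 [hS qmax]]]].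
  exists Q1, Q2; split=> // -[[q' Q1'] Q2'] hS'.
  by apply: qmax; apply/feasP; exists Q1', Q2'.
split=> [|q' /feasP[Q1' [Q2' hS']]]; first by apply/feasP; exists Q1, Q2.
exact: (qmax (q', Q1', Q2')).
Qed.
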